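(* Suppose that the system $\dot\xi_t=A(t)\xi_t$, $\zeta_t=C(t)\xi_t$ is observable on any interval $[a',b']\subset[0,T]$, that $t\mapsto A(t)$ is continuous, and that $t\mapsto C(t)$ is continuously differentiable. Let $a\in(0,1)$ and assume that the intra-trajectory inter-sampling-time bound $\Delta'$ satisfies $$\Delta'\le\frac{4(1-a)\,\lambda_{\min}^*}{\tau^{\mathrm{up}}\ \max_{\tau^{\mathrm{low}}\le t\le T,\ \max\{0,t-\tau^{\mathrm{up}}\}\le s\le t}\|K_s(s,t)\|},$$ where $K_s(s,t):=\frac{\partial}{\partial s}K(s,t)$ and $\lambda^*_{\min}:=\min_{t\in[0,T-\tau^{\mathrm{low}}]}\lambda_{\min}(\mathcal W_{\tau^{\mathrm{low}}}(t))$. Then the system is sampled-data observable, i.e., for every $i\in\{1,\dots,\bar N\}$ the matrix $\bm{\mathcal O}_i$ is left invertible. In addition, for every such $i$, $$\lambda_{\min}(\bm{\mathcal O}_i^\top\bm W_i\bm W_i\bm{\mathcal O}_i)\ge a\,\lambda^*_{\min}.$$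
   Context: Here $A(t)\in\mathbb{R}^{d\times d}$, $C(t)\in\mathbb{R}^{m\times d}$, and $\Phi(t,s)\in\mathbb{R}^{d\times d}$ ($t,s\ge0$) is the fundamental matrix of $\dot\xi=A(t)\xi$, i.e. $\xi_t=\Phi(t,s)\xi_s$. Observability on $[a',b']$ ($a'<b'$) means that an output vanishing identically on $[a',b']$ forces the state to be zero. Sampling: there are $\bar N$ trajectories; from trajectory $i$ outputs are sampled at times $0\le t_i^1<\dots<t_i^\ell\le T$ ($\ell\ge2$), with $0\le t_1^\ell\le\dots\le t_{\bar N}^\ell=T$. An intra-trajectory inter-sampling-time bound is any $\Delta'>0$ with $t_i^l-t_i^{l-1}\le\Delta'$ for all $l\in\{2,\dots,\ell\}$, $i\in\{1,\dots,\bar N\}$. Let $\tau(i):=t_i^\ell-t_i^1$, $\tau^{\mathrm{low}}:=\min_i\tau(i)>0$, $\tau^{\mathrm{up}}:=\max_i\tau(i)$, and $\tau_l(i):=t_i^{l+1}-t_i^l$ for $l\in\{1,\dots,\ell-1\}$. Sample-observability matrix: $\bm{\mathcal O}_i\in\mathbb{R}^{\ell m\times d}$ is the matrix with stacked blocks $C(t_i^1)\Phi(t_i^1,t_i^\ell),\ C(t_i^2)\Phi(t_i^2,t_i^\ell),\dots,C(t_i^\ell)$. $K(s,t):=\Phi(s,t)^\top C(s)^\top C(s)\Phi(s,t)$ and $\mathcal W_\varsigma(t):=\int_t^{t+\varsigma}K(s,t+\varsigma)\,ds$. Weights: $\bm W_i:=\operatorname{diag}(w_1(i),\dots,w_\ell(i))\otimes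 I_m$ with $w_l(i)>0$, $w_1^2(i)=\tau_1(i)/2$, $w_l^2(i)=(\tau_{l-1}(i)+\tau_l(i))/2$ for $l\in\{2,\dots,\ell-1\}$, $w_\ell^2(i)=\tau_{\ell-1}(i)/2$ ($\otimes$ is the Kronecker product). $\|\cdot\|$ is the norm induced by the Euclidean norm and $\lambda_{\min}$ the smallest eigenvalue of a symmetric matrix. *)

(* Defs.v *)
From HB Require Import structures.
From mathcomp Require Import all_boot all_order all_algebra.
From mathcomp Require Import mxtens.
From mathcomp Require Import all_classical all_reals all_analysis.

Set Implicit Arguments.
Unset Strict Implicit.
Unset Printing Implicit Defensive.

Import Order.TTheory GRing.Theory Num.Theory.
Import numFieldNormedType.Exports.

Local Open Scope classical_set_scope.
Local Open Scope ring_scope.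

Section Calculus.
Variables (R : realType) (V : normedModType R).

(* The time axis is [0, +oo[: functions of time are functions on R of which
   only the values at nonnegative times matter. The derivative at 0 is thus
   the right derivative; at x > 0 it is the usual two-sided one. *)
Definition time_derivative (f : R -> V) (x : R) (l : V) : Prop :=
  (y - x)^-1 *: (f y - f x) @[y --> within [set y | 0 <= y] x^'] --> l.

Definition time_derive (f : R -> V) (x : R) : V :=
  lim ((y - x)^-1 *: (f y - f x) @[y --> within [set y | 0 <= y] x^']).

Definition continuously_differentiable (f : R -> V) : Prop :=
  exists f' : R -> V,
    (forall x, 0 <= x -> time_derivative f x (f' x)) /\
    {within `[0, +oo[, continuous f'}.

End Calculus.

Section LinearAlgebra.
Variable R : realType.

Definition enorm n (x : 'cV[R]_n) : R := Num.sqrt (\sum_i x i 0 ^+ 2).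

Definition opnorm p q (M : 'M[R]_(p, q)) : R :=
  sup [set enorm (M *m x) | x in [set x : 'cV[R]_q | enorm x <= 1]].

(* For symmetric M of positive size the spectrum is finite and nonempty, so the
   infimum is its smallest element. *)
Definition lambda_min n (M : 'M[R]_n) : R := inf [set x | eigenvalue M x].

Definition left_invertible p q (M : 'M[R]_(p, q)) : Prop :=
  exists L : 'M[R]_(q, p), L *m M = 1%:M.

End LinearAlgebra.

Section System.
Variables (R : realType) (d m : nat).
Variables (A : R -> 'M[R]_d) (C : R -> 'M[R]_(m, d)) (Phi : R -> R -> 'M[R]_d).

Definition is_trajectory (xi : R -> 'cV[R]_d) : Prop :=
  forall t, 0 <= t -> time_derivative xi t (A t *m xi t).

Definition observable_on (a' b' : R) : Prop :=
  forall xi, is_trajectory xi ->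
    (forall t, a' <= t <= b' -> C t *m xi t = 0) ->
    forall t, a' <= t <= b' -> xi t = 0.

(* For continuous A this determines Phi t s for all t, s >= 0, and then
   xi t = Phi t s *m xi s for every trajectory xi. *)
Definition is_fundamental_matrix : Prop :=
  forall s, 0 <= s ->
    Phi s s = 1%:M /\
    forall t, 0 <= t -> time_derivative (Phi^~ s) t (A t *m Phi t s).

Definition K (s t : R) : 'M[R]_d := (Phi s t)^T *m (C s)^T *m C s *m Phi s t.

Definition Ks (s t : R) : 'M[R]_d := time_derive (K^~ t) s.

Definition gramian (vs t : R) : 'M[R]_d :=
  \matrix_(j, k) \int[lebesgue_measure]_(s in `[t, t + vs]) K s (t + vs) j k.

(* The minimum over [0, T - tau_low], written as an infimum: it is attained
   when A and C are continuous. *)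
Definition lambda_star (tau_low T : R) : R :=
  inf [set lambda_min (gramian tau_low t) | t in `[0, T - tau_low]].

(* The maximum over a compact set of pairs (s, t), written as a supremum: it is
   attained when A is continuous and C is C^1. *)
Definition Ks_max (tau_low tau_up T : R) : R :=
  sup [set r | exists s t,
    [/\ tau_low <= t <= T, Num.max 0 (t - tau_up) <= s <= t
      & r = opnorm (Ks s t)]].

End System.

(* t i l is the l-th sampling time of the i-th trajectory; both indices start
   at 1, and only 1 <= i <= N, 1 <= l <= ell are meaningful. *)
Section Sampling.
Variables (R : realType) (N ell : nat) (t : nat -> nat -> R).

Record is_sampling (T : R) : Prop := {
  sampling_ge0 : forall i, (1 <= i <= N)%N -> 0 <= t i 1;
  sampling_lt : forall i l, (1 <= i <= N)%N -> (1 <= l < ell)%N ->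
    t i l < t i l.+1;
  sampling_leT : forall i, (1 <= i <= N)%N -> t i ell <= T;
  sampling_last_le : forall i, (1 <= i < N)%N -> t i ell <= t i.+1 ell;
  sampling_lastT : t N ell = T }.

Definition is_intersampling_bound (Delta : R) : Prop :=
  0 < Delta /\
  forall i l, (1 <= i <= N)%N -> (2 <= l <= ell)%N -> t i l - t i l.-1 <= Delta.

Definition tau (i : nat) : R := t i ell - t i 1.

Definition tau_low : R := \big[Num.min/tau 1]_(1 <= i < N.+1) tau i.

Definition tau_up : R := \big[Num.max/tau 1]_(1 <= i < N.+1) tau i.

Definition taul (i l : nat) : R := t i l.+1 - t i l.

Definition weight (i l : nat) : R :=
  Num.sqrt (if l == 1%N then taul i 1 / 2
            else if l == ell then taul i ell.-1 / 2
            else (taul i l.-1 + taul i l) / 2).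

Definition weight_mx (m i : nat) : 'M[R]_(ell * m) :=
  diag_mx (\row_(l < ell) weight i l.+1) *t (1%:M : 'M[R]_m).

(* Row k of the stack is row (mxtens_unindex k).2 of block (mxtens_unindex k).1,
   the indexing used by the Kronecker product *t. *)
Definition obs_mx (d m : nat) (C : R -> 'M[R]_(m, d)) (Phi : R -> R -> 'M[R]_d)
    (i : nat) : 'M[R]_(ell * m, d) :=
  \matrix_(k, j)
    let l := (mxtens_unindex k).1 in
    (C (t i l.+1) *m Phi (t i l.+1) (t i ell)) (mxtens_unindex k).2 j.

Definition sampled_data_observable (d m : nat) (C : R -> 'M[R]_(m, d))
    (Phi : R -> R -> 'M[R]_d) : Prop :=
  forall i, (1 <= i <= N)%N -> left_invertible (obs_mx C Phi i).

End Sampling.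

(* Main.v *)
Require Import Defs.
From HB Require Import structures.
From mathcomp Require Import all_boot all_order all_algebra.
From mathcomp Require Import mxtens.
From mathcomp Require Import all_classical all_reals all_analysis.
From mathcomp Require Import ring lra.

Set Implicit Arguments.
Unset Strict Implicit.
Unset Printing Implicit Defensive.

Import Order.TTheory GRing.Theory Num.Theory.
Import numFieldNormedType.Exports.

Local Open Scope classical_set_scope.
Local Open Scope ring_scope.

(** Fix a trajectory [i], write [te] for its last sampling time and, for a vector
    [x], let [g s := x^T K(s, te) x = |C(s) Phi(s, te) x|^2 >= 0]. The weights
    are those of the trapezoidal rule: by [qform_weighted_obs] and
    [sum_weight_trapezoid], [x^T O^T W W O x] is the trapezoidal approximation of
    the integral of [g] over [[t i 1, te]]. Two estimates give the theorem.

    - From below, that integral is at least [lambda_star * |x|^2], because [g]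
      is nonnegative and the interval contains [[te - tau_low, te]], on which the
      integral of [g] is the quadratic form of a Gramian.

    - The trapezoidal error on a step of length [h] is at most [M h^2 / 4] when
      [g] is [M]-Lipschitz ([Rintegral_le_trapezoid]), and
      [M := Ks_max * |x|^2] is a Lipschitz constant by the mean value theorem.
      As the steps are at most [Delta] and add up to at most [tau_up], the total
      error is at most [M Delta tau_up / 4], hence by the choice of [Delta] at
      most [(1 - a) lambda_star |x|^2].

    So [x^T O^T W W O x >= a lambda_star |x|^2], which bounds the smallest
    eigenvalue. The bound on [Delta] forces [lambda_star > 0], since [Delta] is
    positive; the weighted Gram matrix is then invertible and
    [(O^T W W O)^-1 O^T W W] is a left inverse of [O].

    Two facts behind the definitions need work. The infimum [lambda_min] is a
    least eigenvalue because the Rayleigh quotient attains its minimum on the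
    compact unit sphere, at an eigenvector ([rayleigh_minimum]). The supremum
    [Ks_max] bounds its elements because [Ks] is bounded on bounded sets of
    times ([Ks_bounded]): it is a polynomial in [A], [C] and the derivative of [C],
    which are continuous, and in [Phi s t], which is bounded uniformly in both
    arguments by a Gronwall estimate on its squared Frobenius norm
    ([fundamental_matrix_bounded]). *)

(** * Frobenius norms, operator norms and quadratic forms *)

Section QuadraticForms.
Variable R : realType.

(** Lagrange's identity: twice the difference of the two sides is a sum of
    squares. *)
Lemma cauchy_schwarz (I : finType) (u v : I -> R) :
  (\sum_i u i * v i) ^+ 2 <= (\sum_i u i ^+ 2) * (\sum_i v i ^+ 2).
Proof.
suff: 0 <= 2 * ((\sum_i u i ^+ 2) * (\sum_i v i ^+ 2) - (\sum_i u i * v i) ^+ 2).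
  by rewrite pmulr_rge0 ?subr_ge0.
suff -> : 2 * ((\sum_i u i ^+ 2) * (\sum_i v i ^+ 2) - (\sum_i u i * v i) ^+ 2)
    = \sum_i \sum_j (u i * v j - u j * v i) ^+ 2.
  by apply: sumr_ge0 => i _; apply: sumr_ge0 => j _; exact: sqr_ge0.
have E (p q : I -> R) : \sum_i \sum_j p i * q j = (\sum_i p i) * (\sum_i q i).
  by rewrite mulr_suml; apply: eq_bigr => i _; rewrite mulr_sumr.
have -> : \sum_i \sum_j (u i * v j - u j * v i) ^+ 2 =
    \sum_i \sum_j u i ^+ 2 * v j ^+ 2 + \sum_i \sum_j v i ^+ 2 * u j ^+ 2
    - 2 * \sum_i \sum_j (u i * v i) * (u j * v j).
  rewrite mulr_sumr -big_split -sumrB; apply: eq_bigr => i _.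
  rewrite mulr_sumr -big_split -sumrB; apply: eq_bigr => j _ /=.
  by ring.
by rewrite !E; ring.
Qed.

(** The squared Frobenius norm: working with squares keeps every estimate below
    polynomial, and [frob2] of a column is its squared Euclidean norm. *)
Definition frob2 p q (M : 'M[R]_(p, q)) : R := \sum_i \sum_j M i j ^+ 2.

Lemma frob2_ge0 p q (M : 'M[R]_(p, q)) : 0 <= frob2 M.
Proof. by apply: sumr_ge0 => i _; apply: sumr_ge0 => j _; exact: sqr_ge0. Qed.

Lemma frob2_entry p q (M : 'M[R]_(p, q)) i j : M i j ^+ 2 <= frob2 M.
Proof.
rewrite /frob2 (bigD1 i)//= (bigD1 j)//= -addrA lerDl addr_ge0//.
  by apply: sumr_ge0 => k _; exact: sqr_ge0.
by apply: sumr_ge0 => k _; apply: sumr_ge0 => l _; exact: sqr_ge0.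
Qed.

Lemma frob2_eq0 p q (M : 'M[R]_(p, q)) : frob2 M = 0 -> M = 0.
Proof.
move=> M0; apply/matrixP => i j; rewrite mxE; apply/eqP.
by rewrite -sqrf_eq0 eq_le sqr_ge0 -M0 frob2_entry.
Qed.

Lemma frob2_tr p q (M : 'M[R]_(p, q)) : frob2 M^T = frob2 M.
Proof.
by rewrite /frob2 exchange_big; do 2 apply: eq_bigr => ? _; rewrite mxE.
Qed.

Lemma frob2Z p q (M : 'M[R]_(p, q)) c : frob2 (c *: M) = c ^+ 2 * frob2 M.
Proof.
rewrite mulr_sumr; apply: eq_bigr => i _; rewrite mulr_sumr.
by apply: eq_bigr => j _; rewrite mxE exprMn.
Qed.

Lemma frob2D p q (M1 M2 : 'M[R]_(p, q)) :
  frob2 (M1 + M2) <= 2 * (frob2 M1 + frob2 M2).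
Proof.
rewrite -big_split mulr_sumr; apply: ler_sum => i _.
rewrite -big_split mulr_sumr; apply: ler_sum => j _ /=.
rewrite mxE -subr_ge0.
have -> : 2 * (M1 i j ^+ 2 + M2 i j ^+ 2) - (M1 i j + M2 i j) ^+ 2 =
  (M1 i j - M2 i j) ^+ 2 by ring.
exact: sqr_ge0.
Qed.

Lemma frob2M p q r (M1 : 'M[R]_(p, q)) (M2 : 'M[R]_(q, r)) :
  frob2 (M1 *m M2) <= frob2 M1 * frob2 M2.
Proof.
rewrite -(frob2_tr M2) mulr_suml; apply: ler_sum => i _.
rewrite mulr_sumr; apply: ler_sum => j _.
rewrite mxE; apply: le_trans (cauchy_schwarz _ _) _.
by under [X in _ <= _ * X]eq_bigr do rewrite mxE.
Qed.

Lemma frob2_le_norm p q (M : 'M[R]_(p, q)) : frob2 M <= (p * q)%:R * `|M| ^+ 2.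
Proof.
have le_entry i j : M i j ^+ 2 <= `|M| ^+ 2.
  rewrite -real_normK ?num_real// lerXn2r ?nnegrE//.
  by rewrite [leRHS]/Num.Def.normr/= mx_normrE; exact: (le_bigmax _ _ (i, j)).
apply: (@le_trans _ _ (\sum_(i < p) \sum_(j < q) `|M| ^+ 2)).
  by apply: ler_sum => i _; apply: ler_sum => j _; exact: le_entry.
by rewrite !sumr_const !card_ord -mulrnA mulr_natl mulnC.
Qed.

Definition qform n (M : 'M[R]_n) (x : 'cV[R]_n) : R := (x^T *m M *m x) 0 0.

Lemma qformE n (M : 'M[R]_n) x : qform M x = \sum_i \sum_j x i 0 * M i j * x j 0.
Proof.
rewrite /qform mxE exchange_big; apply: eq_bigr => j _.
by rewrite mxE mulr_suml; apply: eq_bigr => i _; rewrite mxE.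
Qed.

Lemma qform_gram p n (Z : 'M[R]_(p, n)) x : qform (Z^T *m Z) x = frob2 (Z *m x).
Proof.
rewrite /qform mulmxA -mulmxA -trmx_mul mxE; apply: eq_bigr => i _.
by rewrite big_ord1 mxE expr2.
Qed.

Lemma qform1 n (x : 'cV[R]_n) : qform 1%:M x = frob2 x.
Proof. by rewrite -{1}(trmx1 R n) -[X in qform X]mulmx1 qform_gram mul1mx. Qed.

Lemma enormE n (x : 'cV[R]_n) : enorm x = Num.sqrt (frob2 x).
Proof. by congr Num.sqrt; apply: eq_bigr => i _; rewrite big_ord1. Qed.

Lemma enorm_mulmx_le p q (M : 'M[R]_(p, q)) x :
  enorm (M *m x) <= Num.sqrt (frob2 M) * enorm x.
Proof.
by rewrite !enormE -sqrtrM ?frob2_ge0// ler_wsqrtr// frob2M.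
Qed.

Lemma opnorm_set_ubound p q (M : 'M[R]_(p, q)) :
  ubound [set enorm (M *m x) | x in [set x : 'cV[R]_q | enorm x <= 1]]
    (Num.sqrt (frob2 M)).
Proof.
move=> _ [x /= x1 <-]; apply: le_trans (enorm_mulmx_le _ _) _.
by rewrite ler_piMr ?sqrtr_ge0.
Qed.

Lemma opnorm_ge0 p q (M : 'M[R]_(p, q)) : 0 <= opnorm M.
Proof.
apply: ub_le_sup; first by eexists; exact: opnorm_set_ubound.
by exists 0; rewrite /= ?mulmx0 /enorm big1 ?sqrtr0// => i _; rewrite mxE expr0n.
Qed.

Lemma opnorm_le_frob p q (M : 'M[R]_(p, q)) : opnorm M <= Num.sqrt (frob2 M).
Proof.
apply: ge_sup; last exact: opnorm_set_ubound.
exists (enorm (M *m 0)); exists 0 => //=.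
by rewrite /enorm big1 ?sqrtr0// => i _; rewrite mxE expr0n.
Qed.

(** Homogeneity extends the defining bound of [opnorm] from the unit ball; the
    Frobenius bound makes the supremum finite. *)
Lemma enorm_mulmx_le_opnorm p q (M : 'M[R]_(p, q)) x :
  enorm (M *m x) <= opnorm M * enorm x.
Proof.
have [x0|x0] := eqVneq (frob2 x) 0.
  by rewrite (frob2_eq0 x0) mulmx0 !enormE /frob2 !big1 ?sqrtr0 ?mulr0// =>
    i _; rewrite big1// => j _; rewrite mxE expr0n.
have x_gt0 : 0 < enorm x by rewrite enormE sqrtr_gt0 lt0r x0 frob2_ge0.
rewrite -ler_pdivrMr//; apply: ub_le_sup.
  by eexists; exact: opnorm_set_ubound.
have enormZ r (y : 'cV[R]_r) : enorm ((enorm x)^-1 *: y) = enorm y / enorm x.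
  rewrite !enormE frob2Z sqrtrM ?sqr_ge0// sqrtr_sqr ger0_norm ?invr_ge0//.
  by rewrite mulrC.
exists ((enorm x)^-1 *: x); first by rewrite /= enormZ divff// gt_eqF.
by rewrite -scalemxAr enormZ.
Qed.

Lemma qform_le_opnorm n (M : 'M[R]_n) x : `|qform M x| <= opnorm M * frob2 x.
Proof.
apply: (@le_trans _ _ (enorm x * enorm (M *m x))).
  rewrite !enormE -sqrtrM ?frob2_ge0// -sqrtr_sqr ler_wsqrtr//.
  rewrite /qform -mulmxA mxE.
  under eq_bigr do rewrite mxE.
  rewrite [leRHS](_ : _ = (\sum_i x i 0 ^+ 2) * \sum_i (M *m x) i 0 ^+ 2).
    exact: cauchy_schwarz.
  by congr (_ * _); apply: eq_bigr => i _; rewrite big_ord1.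
apply: (@le_trans _ _ (enorm x * (opnorm M * enorm x))).
  by rewrite ler_wpM2l ?enorm_mulmx_le_opnorm// sqrtr_ge0.
by rewrite mulrCA enormE -expr2 sqr_sqrtr ?frob2_ge0.
Qed.

End QuadraticForms.

(** * The smallest eigenvalue of a symmetric matrix *)

Section SmallestEigenvalue.
Variable R : realType.

Lemma continuous_frob2 p q : continuous (@frob2 R p q).
Proof.
apply: continuous_big => [|i _]; first exact: add_continuous.
apply: continuous_big => [|j _]; first exact: add_continuous.
move=> M; apply: (@continuous_comp _ _ _ (fun M : 'M[R]_(p, q) => M i j)
  (fun x => x ^+ 2)); first exact: coord_continuous.
exact: exprn_continuous.
Qed.

Lemma continuous_qform_row n (M : 'M[R]_n) :
  continuous (fun v : 'rV[R]_n => qform M v^T).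
Proof.
have -> : (fun v : 'rV[R]_n => qform M v^T) =
    fun v => \sum_i \sum_j (v 0 i * M i j) * v 0 j.
  apply/funext => v; rewrite qformE; do 2 apply: eq_bigr => ? _.
  by rewrite !mxE.
apply: continuous_big => [|i _]; first exact: add_continuous.
apply: continuous_big => [|j _]; first exact: add_continuous.
move=> v; apply: (@continuousM _ _ (fun v : 'rV[R]_n => v 0 i * M i j)).
  apply: (@continuousM _ _ (fun v : 'rV[R]_n => v 0 i)).
    exact: coord_continuous.
  exact: cst_continuous.
exact: coord_continuous.
Qed.

Lemma compact_sphere n : compact [set v : 'rV[R]_n | frob2 v = 1].
Proof.
apply: bounded_closed_compact.
  exists 1; split => // b b1 v /= v1; apply: le_trans (ltW b1).
  rewrite [leLHS]/Num.Def.normr/= mx_normrE; apply: bigmax_le => // -[i j] _ /=.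
  by rewrite -(@ler_pXn2r _ 2) ?nnegrE// expr1n real_normK ?num_real// -v1 frob2_entry.
apply: (@preimage_closed _ _ (@frob2 R 1 n) [set x | x = 1]); last exact: closed_eq.
by move=> v _; exact: continuous_frob2.
Qed.

Lemma trmx_add p q (M1 M2 : 'M[R]_(p, q)) : (M1 + M2)^T = M1^T + M2^T.
Proof. exact: linearD. Qed.

Lemma trmx_scale p q c (M : 'M[R]_(p, q)) : (c *: M)^T = c *: M^T.
Proof. exact: linearZ. Qed.

Lemma qformD n (M : 'M[R]_n) x y : M^T = M ->
  qform M (x + y) = qform M x + 2 * (y^T *m (M *m x)) 0 0 + qform M y.
Proof.
move=> Msym; have entryD (P Q : 'M[R]_1) : (P + Q) 0 0 = P 0 0 + Q 0 0.
  by rewrite mxE.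
rewrite /qform trmx_add !mulmxDl !mulmxDr !entryD mulmxA.
have -> : (x^T *m M *m y) 0 0 = (y^T *m M *m x) 0 0.
  by rewrite -[in LHS](trmxK y) -[in LHS]Msym -!trmx_mul mulmxA [LHS]mxE.
by ring.
Qed.

Lemma qformZ n (M : 'M[R]_n) x c : qform M (c *: x) = c ^+ 2 * qform M x.
Proof.
rewrite /qform trmx_scale -!scalemxAl -!scalemxAr scalerA -expr2.
exact: mxE.
Qed.

(** Moving from [x] in the direction [y := M *m x] changes the form by
    [2 e |y|^2 + e^2 (y^T M y)], which is negative for small negative [e] unless
    [y = 0]. *)
Lemma psd_qform_eq0 n (M : 'M[R]_n) x : M^T = M ->
  (forall y, 0 <= qform M y) -> qform M x = 0 -> M *m x = 0.
Proof.
move=> Msym Mge0 Mx0; apply: frob2_eq0; set y := M *m x.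
have yy : (y^T *m y) 0 0 = frob2 y by rewrite -qform1 /qform mulmx1.
have entryZ c (P : 'M[R]_1) : (c *: P) 0 0 = c * P 0 0 by rewrite mxE.
have b0 := frob2_ge0 y; have c0 := Mge0 y.
set e := - (1 + qform M y)^-1 * frob2 y.
have := Mge0 (x + e *: y).
rewrite qformD// Mx0 qformZ trmx_scale -scalemxAl entryZ -/y yy add0r.
have c1 : 0 < 1 + qform M y by rewrite ltr_pwDl.
apply: contraTeq => /eqP fy0; rewrite -ltNge.
have b_gt0 : 0 < frob2 y by rewrite lt0r b0 andbT; apply/eqP.
have -> : 2 * (e * frob2 y) + e ^+ 2 * qform M y =
   - ((frob2 y / (1 + qform M y)) ^+ 2 * (2 + qform M y)).
  by rewrite /e; field; rewrite gt_eqF.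
rewrite oppr_lt0 mulr_gt0 ?exprn_gt0 ?divr_gt0//.
by rewrite ltr_pwDl.
Qed.

(** At a minimum [v] of the form on the unit sphere, with value [l], the form of
    [M - l] is nonnegative and vanishes at [v], so [v] is in its kernel. *)
Lemma rayleigh_minimum n (M : 'M[R]_n) : (0 < n)%N -> M^T = M ->
  exists2 l, eigenvalue M l & forall x, l * frob2 x <= qform M x.
Proof.
move=> n0 Msym.
have [v v1 vmin] : exists2 v, v \in [set v : 'rV[R]_n | frob2 v = 1] &
    forall w, w \in [set v : 'rV[R]_n | frob2 v = 1] -> qform M v^T <= qform M w^T.
  apply: EVT_min_rV; last 2 first.
  - exact: compact_sphere.
  - exact/continuous_subspaceT/continuous_qform_row.
  exists (delta_mx 0 (Ordinal n0)).
  rewrite /= /frob2 big_ord1 (bigD1 (Ordinal n0))//= big1 ?addr0 => [|j jn0].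
    by rewrite mxE !eqxx expr1n.
  by rewrite mxE eqxx (negbTE jn0) expr0n.
rewrite inE /= in v1; set l := qform M v^T in vmin *.
have lmin x : l * frob2 x <= qform M x.
  have [x0|x0] := eqVneq (frob2 x) 0.
    by rewrite (frob2_eq0 x0) /qform trmx0 !mul0mx [leRHS]mxE -(frob2_eq0 x0) x0 mulr0.
  have fx_gt0 : 0 < frob2 x by rewrite lt0r x0 frob2_ge0.
  have := vmin ((Num.sqrt (frob2 x))^-1 *: x^T).
  rewrite inE /= frob2Z frob2_tr exprVn sqr_sqrtr ?frob2_ge0// mulVf//.
  move=> /(_ erefl); rewrite trmx_scale trmxK qformZ exprVn sqr_sqrtr ?frob2_ge0//.
  by rewrite ler_pdivlMl// mulrC.
exists l => //; apply/eigenvalueP; exists v; last first.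
  apply: contra_eq_neq v1 => ->.
  by rewrite /frob2 big_ord1 big1 ?(eq_sym 0) ?oner_neq0// => i _; rewrite mxE expr0n.
have qB x : qform (M - l%:M) x = qform M x - l * frob2 x.
  rewrite -qform1 /qform mulmxBr mulmxBl mul_mx_scalar mulmx1 -scalemxAl.
  by rewrite [LHS]mxE; congr (_ + _); rewrite [LHS]mxE; congr (- _); exact: mxE.
have : (M - l%:M) *m v^T = 0.
  apply: psd_qform_eq0 => [|y|]; first by rewrite linearB /= tr_scalar_mx Msym.
    by rewrite qB subr_ge0.
  by rewrite qB frob2_tr v1 mulr1 subrr.
move=> /(congr1 trmx); rewrite trmx_mul trmxK trmx0 linearB /= tr_scalar_mx Msym.
by rewrite mulmxBr mul_mx_scalar => /eqP; rewrite subr_eq0 => /eqP.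
Qed.

Lemma le_eigenvalue n (M : 'M[R]_n) c l :
  (forall x, c * frob2 x <= qform M x) -> eigenvalue M l -> c <= l.
Proof.
move=> cM /eigenvalueP[v vM v0].
have v_gt0 : 0 < frob2 v.
  by rewrite lt0r frob2_ge0 andbT; apply: contra_neq v0 => /frob2_eq0.
have := cM v^T; rewrite /qform trmxK vM -scalemxAl [X in _ <= X]mxE.
rewrite (_ : (v *m v^T) 0 0 = frob2 v^T).
  by rewrite frob2_tr ler_pM2r.
by rewrite -qform1 /qform mulmx1 trmxK.
Qed.

Lemma lambda_min_ge n (M : 'M[R]_n) c : (0 < n)%N -> M^T = M ->
  (forall x, c * frob2 x <= qform M x) -> c <= lambda_min M.
Proof.
move=> n0 Msym cM; apply: lb_le_inf => [|l /=]; last exact: le_eigenvalue.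
by have [l lM _] := rayleigh_minimum n0 Msym; exists l.
Qed.

Lemma lambda_min_qform n (M : 'M[R]_n) x : (0 < n)%N -> M^T = M ->
  lambda_min M * frob2 x <= qform M x.
Proof.
move=> n0 Msym; have [l lM lmin] := rayleigh_minimum n0 Msym.
apply: le_trans (lmin x); rewrite ler_wpM2r ?frob2_ge0//.
apply: ge_inf => //; exists l => m /=; exact: le_eigenvalue.
Qed.

Lemma posdef_unitmx n (M : 'M[R]_n) c : 0 < c ->
  (forall x, c * frob2 x <= qform M x) -> M \in unitmx.
Proof.
move=> c0 cM; rewrite unitmxE unitfE; apply/det0P => -[v v0 vM].
have := cM v^T; rewrite /qform trmxK vM mul0mx [leRHS]mxE frob2_tr.
rewrite pmulr_rle0// => fv.
by move/eqP: v0; apply; apply: frob2_eq0; apply/eqP; rewrite eq_le fv frob2_ge0.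
Qed.

End SmallestEigenvalue.

(** * Calculus on the time axis *)

Section TimeDerivative.
Variable R : realType.

(** Nondegeneracy at [x >= 0], the point [0] included, comes from the times to
    the right of [x]; it makes the limits of difference quotients unique. *)
Lemma time_filter_proper (x : R) : 0 <= x ->
  ProperFilter (within [set y | 0 <= y] x^').
Proof.
move=> x0; apply: Build_ProperFilter => /= H.
suff /filter_ex[y []] : \forall y \near x^'+, x < y /\ False by [].
apply: filterI; first exact: nbhs_right_gt.
change (nbhs x (fun y => x < y -> False)).
have : nbhs x (fun y => y != x -> 0 <= y -> False) := H.
apply: filterS => y yF xy; apply: yF; first by rewrite gt_eqF.
by rewrite ltW// (le_lt_trans x0).
Qed.

Lemma cvg_mxP (T : Type) (F : set_system T) (FF : Filter F) p q
    (f : T -> 'M[R]_(p, q)) (l : 'M[R]_(p, q)) :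
  f @ F --> l <-> forall i j, f y i j @[y --> F] --> l i j.
Proof.
split => [fl i j|fl].
  by apply: (@cvg_comp _ _ _ f (fun M : 'M[R]_(p, q) => M i j) F (nbhs l)) => //;
    exact: coord_continuous.
apply/cvgrPdist_le => e e0; near=> y.
rewrite [leLHS]/Num.Def.normr/= mx_normrE (bigmax_le _ (ltW e0))//= => k _.
rewrite !mxE/=; move: k; near: y; apply: filter_forall => /= k.
by have /cvgrPdist_le := fl k.1 k.2; apply.
Unshelve. all: by end_near. Qed.

Lemma time_derivative_mxP p q (f : R -> 'M[R]_(p, q)) x l :
  time_derivative f x l <->
  forall i j, time_derivative (fun y => f y i j) x (l i j).
Proof.
apply: (iff_trans (cvg_mxP _ _ _)).
by split => fl i j; have := fl i j; apply: cvg_trans; apply: near_eq_cvg;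
  near=> y; rewrite !mxE.
Unshelve. all: by end_near. Qed.

(** [f y = f x + (y - x) q(y)], where the difference quotient [q] converges. *)
Lemma time_derivative_cvg (V : normedModType R) (f : R -> V) x l :
  time_derivative f x l -> f y @[y --> within [set y | 0 <= y] x^'] --> f x.
Proof.
move=> fl; rewrite -[X in _ --> X](addr0 (f x)) -(scale0r l).
have d0 : y - x @[y --> within [set y | 0 <= y] x^'] --> (0 : R).
  rewrite -(subrr x); apply: cvgB; last exact: cvg_cst.
  apply: cvg_within_filter.
  by apply: cvg_trans (@cvg_id _ (nbhs x)); exact: nbhs_dnbhs.
apply: cvg_trans (cvgD (cvg_cst (f x)) (cvgZ d0 fl)).
apply: near_eq_cvg; rewrite near_withinE; near=> y => y0.
change (f x + (y - x) *: ((y - x)^-1 *: (f y - f x)) = f y).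
rewrite scalerA divff ?scale1r; first by rewrite addrC subrK.
by rewrite subr_eq0; near: y; exact: nbhs_dnbhs_neq.
Unshelve. all: by end_near. Qed.

Lemma time_derivative_continuous (V : normedModType R) (f : R -> V) f' :
  (forall x, 0 <= x -> time_derivative f x (f' x)) ->
  {within `[0, +oo[, continuous f}.
Proof.
move=> ff'; apply/subspace_continuousP => x /=; rewrite in_itv/= andbT => x0.
apply/cvgrPdist_lt => e e0.
have /cvgrPdist_lt/(_ _ e0) := time_derivative_cvg (ff' _ x0).
rewrite !near_withinE; apply: filterS => y /= H.
rewrite in_itv/= andbT => y0.
by have [->|yx] := eqVneq y x; [rewrite subrr normr0|exact: H].
Qed.

Lemma time_derivative_cst (V : normedModType R) (v : V) x :
  time_derivative (fun=> v) x 0.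
Proof.
rewrite /time_derivative.
rewrite (_ : (fun y => _) = (fun=> 0)); first exact: cvg_cst.
by apply/funext => y; rewrite subrr scaler0.
Qed.

Lemma time_derivative_sum (I : finType) (f : I -> R -> R) x l :
  (forall i, time_derivative (f i) x (l i)) ->
  time_derivative (fun y => \sum_i f i y) x (\sum_i l i).
Proof.
move=> fl.
rewrite /time_derivative.
rewrite (_ : (fun y => _) = fun y => \sum_i (y - x)^-1 *: (f i y - f i x)).
  by apply: cvg_big => [|i _]; [exact: add_continuous|exact: fl].
by apply/funext => y; rewrite -sumrB scaler_sumr.
Qed.

Lemma time_derivativeM (f g : R -> R) x f' g' :
  time_derivative f x f' -> time_derivative g x g' ->
  time_derivative (fun y => f y * g y) x (f' * g x + f x * g').
Proof.
move=> ff' gg'.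
have gc := time_derivative_cvg gg'.
apply: cvg_trans (cvgD (cvgM ff' gc) (cvgM (cvg_cst (f x)) gg')).
apply: near_eq_cvg; near=> y.
change ((y - x)^-1 * (f y - f x) * g y + f x * ((y - x)^-1 * (g y - g x)) =
  (y - x)^-1 * (f y * g y - f x * g x)).
by ring.
Unshelve. all: by end_near. Qed.

Lemma time_derivative_mulmx p q r (f : R -> 'M[R]_(p, q)) (g : R -> 'M[R]_(q, r))
    x f' g' :
  time_derivative f x f' -> time_derivative g x g' ->
  time_derivative (fun y => f y *m g y) x (f' *m g x + f x *m g').
Proof.
move=> /time_derivative_mxP ff' /time_derivative_mxP gg'.
apply/time_derivative_mxP => i j; rewrite !mxE -big_split.
under [fun y => _]funext do rewrite mxE.
by apply: time_derivative_sum => k; exact: time_derivativeM.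
Qed.

Lemma time_derivative_tr p q (f : R -> 'M[R]_(p, q)) x f' :
  time_derivative f x f' -> time_derivative (fun y => (f y)^T) x f'^T.
Proof.
move=> /time_derivative_mxP ff'; apply/time_derivative_mxP => i j.
rewrite mxE; under [fun y => _]funext do rewrite mxE.
exact: ff'.
Qed.

Lemma time_derivative_is_derive (f : R -> R) (x l : R) :
  0 < x -> time_derivative f x l -> is_derive x 1 f l.
Proof.
move=> x0 fl.
suff fl' : h^-1 *: (f (h *: 1 + x) - f x) @[h --> 0^'] --> l.
  by split; [apply/cvg_ex; exists l|exact: cvg_lim].
apply/cvgrPdist_lt => e e0.
have /cvgrPdist_lt/(_ _ e0) := fl.
rewrite near_withinE !near_withinE/= => H.
have : \forall h \near (0 : R), 0 < h + x /\
    (h + x != x -> 0 <= h + x ->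
      `|l - (h + x - x)^-1 *: (f (h + x) - f x)| < e).
  have hx : h + x @[h --> (0 : R)] --> x.
    by rewrite -[X in _ --> X]add0r; apply: cvgD; [exact: cvg_id|exact: cvg_cst].
  apply: filterI; first exact: (cvgr_gt x hx).
  exact: (hx (fun y => y != x -> 0 <= y -> `|l - (y - x)^-1 *: (f y - f x)| < e) H).
apply: filterS => h /= [hx0 Hh] h0.
rewrite -[h in X in X < _]/(h) [h *: 1](_ : _ = h); last by rewrite /GRing.scale/= mulr1.
have := Hh; rewrite addrK; apply; last exact: ltW.
by rewrite -subr_eq0 addrK.
Qed.

Lemma is_derive_time_derivative (f : R -> R) (x l : R) :
  is_derive x 1 f l -> time_derivative f x l.
Proof.
move=> [df dfl].
have fl : h^-1 *: (f (h *: 1 + x) - f x) @[h --> 0^'] --> l.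
  by rewrite -dfl; exact: df.
apply: cvg_within_filter; apply/cvgrPdist_lt => e e0.
have /cvgrPdist_lt/(_ _ e0) := fl; rewrite !near_withinE => H.
have yx : y - x @[y --> x] --> (0 : R).
  by rewrite -[X in _ --> X](subrr x); apply: cvgB; [exact: cvg_id|exact: cvg_cst].
suff K : nbhs x (fun y => y != x -> `|l - (y - x)^-1 *: (f y - f x)| < e).
  exact: K.
have : nbhs x (fun y => y - x != 0 ->
    `|l - (y - x)^-1 *: (f ((y - x) *: 1 + x) - f x)| < e).
  exact: (yx (fun h => h != 0 ->
    `|l - h^-1 *: (f (h *: 1 + x) - f x)| < e) H).
apply: filterS => y /= Hy yx0; have := Hy; rewrite subr_eq0 => /(_ yx0).
by rewrite [(y - x) *: 1](_ : _ = y - x) ?subrK// /GRing.scale/= mulr1.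
Qed.

(** At the interior points of [[a, b]], all positive, [time_derivative] is the
    two-sided derivative, so that the classical theorem applies. *)
Lemma mean_value (f f' : R -> R) a b :
  (forall x, 0 <= x -> time_derivative f x (f' x)) -> 0 <= a -> a <= b ->
  exists2 c, a <= c <= b & f b - f a = f' c * (b - a).
Proof.
move=> ff' a0 ab.
have [c cab ->] : exists2 c, c \in `[a, b] & f b - f a = f' c * (b - a).
  apply: MVT_segment => // [x|].
    rewrite in_itv/= => /andP[ax _]; apply: time_derivative_is_derive.
      exact: le_lt_trans ax.
    by apply: ff'; rewrite ltW// (le_lt_trans a0).
  apply: continuous_subspaceW (time_derivative_continuous ff') => x /=.
  by rewrite !in_itv/= => /andP[ax _]; rewrite (le_trans a0).
by exists c => //; rewrite in_itv/= in cab.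
Qed.

(** A two-sided bound on [u'] lets the estimate run forward and backward in time:
    [expR (- c x) * u x] is nonincreasing and [expR (c x) * u x] is
    nondecreasing on [[0, T]]. *)
Lemma gronwall (u u' : R -> R) c T s t :
  (forall x, 0 <= x -> time_derivative u x (u' x)) -> (forall x, 0 <= u x) ->
  0 <= c -> (forall x, 0 <= x <= T -> `|u' x| <= c * u x) ->
  0 <= s <= T -> 0 <= t <= T -> u s <= expR (c * T) * u t.
Proof.
move=> uu' u0 c0 u'c /andP[s0 sT] /andP[t0 tT].
have td_exp (k x : R) : time_derivative (fun y => expR (k * y)) x (k * expR (k * x)).
  have h : is_derive x 1 (fun y : R => k * y) k.
    by apply: is_derive_eq; rewrite /GRing.scale/= mulr1.
  have := is_derive1_comp (is_derive_expR (k * x)) h.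
  by rewrite mulrC => /is_derive_time_derivative.
have td k x : 0 <= x ->
    time_derivative (fun y => expR (k * y) * u y) x (expR (k * x) * (k * u x + u' x)).
  move=> x0; have := time_derivativeM (td_exp k x) (uu' x x0).
  by congr time_derivative; ring.
have [st|/ltW ts] := leP s t.
  have [z /andP[sz zt] E] := mean_value (td c) s0 st.
  have : 0 <= expR (c * t) * u t - expR (c * s) * u s.
    rewrite E mulr_ge0 ?subr_ge0// mulr_ge0 ?expR_ge0//.
    have := u'c z; rewrite (le_trans s0 sz) (le_trans zt tT) => /(_ isT).
    by rewrite ler_norml => /andP[+ _]; rewrite lerNl -subr_ge0 opprK addrC.
  rewrite subr_ge0 => H; apply: (@le_trans _ _ (expR (c * s) * u s)).
    by rewrite ler_peMl// -expR0 ler_expR mulr_ge0.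
  by apply: le_trans H _; rewrite ler_wpM2r// ler_expR ler_wpM2l.
have [z /andP[sz zt] E] := mean_value (td (- c)) t0 ts.
have : expR (- c * s) * u s - expR (- c * t) * u t <= 0.
  rewrite E mulr_le0_ge0 ?subr_ge0// mulr_ge0_le0 ?expR_ge0//.
  have := u'c z; rewrite (le_trans t0 sz) (le_trans zt sT) => /(_ isT).
  by rewrite ler_norml => /andP[_ +]; rewrite mulNr addrC subr_le0.
rewrite subr_le0 !mulNr !expRN => H.
rewrite -(@ler_pM2l _ (expR (c * s))^-1) ?invr_gt0 ?expR_gt0//.
apply: le_trans H _; rewrite mulrA ler_wpM2r// -!expRN -expRD ler_expR.
rewrite -lerBlDl opprK addrC -mulrBr ler_wpM2l//.
by rewrite (le_trans _ sT)// gerBl.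
Qed.

Lemma frob2_bounded p q (f : R -> 'M[R]_(p, q)) (T : R) :
  {within `[0, +oo[, continuous f} ->
  exists2 B, 0 <= B & forall s, 0 <= s <= T -> frob2 (f s) <= B.
Proof.
move=> fc.
have /compact_bounded[b [_ bP]] : compact (f @` `[0, T]).
  apply: continuous_compact; last exact: segment_compact.
  apply: continuous_subspaceW fc => x /=.
  by rewrite !in_itv/= => /andP[->].
exists ((p * q)%:R * (b + 1) ^+ 2); first by rewrite mulr_ge0 ?sqr_ge0.
move=> s sT; apply: le_trans (frob2_le_norm _) _.
have : `|f s| <= b + 1.
  by apply: (bP (b + 1)); [rewrite ltrDl|exists s; rewrite //= in_itv].
by move=> fsb; rewrite ler_wpM2l// lerXn2r ?nnegrE// (le_trans _ fsb).
Qed.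

Lemma time_derivative_frob2 p q (f : R -> 'M[R]_(p, q)) x f' :
  time_derivative f x f' ->
  time_derivative (fun s => frob2 (f s)) x
    (\sum_i \sum_j (2 * (f x i j * f' i j))).
Proof.
move=> /time_derivative_mxP ff'.
apply: time_derivative_sum => i; apply: time_derivative_sum => j.
have := time_derivativeM (ff' i j) (ff' i j).
under [fun y => f y i j * _]funext do rewrite -expr2.
by congr time_derivative; ring.
Qed.

Lemma frob2_dot_le p q (M1 M2 : 'M[R]_(p, q)) :
  `|\sum_i \sum_j (2 * (M1 i j * M2 i j))| <= frob2 M1 + frob2 M2.
Proof.
rewrite -big_split; apply: le_trans (ler_norm_sum _ _ _) _.
apply: ler_sum => i _; rewrite -big_split.
apply: le_trans (ler_norm_sum _ _ _) _; apply: ler_sum => j _ /=.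
rewrite ler_norml; apply/andP; split; rewrite -subr_ge0.
  have -> : 2 * (M1 i j * M2 i j) - - (M1 i j ^+ 2 + M2 i j ^+ 2) =
    (M1 i j + M2 i j) ^+ 2 by ring.
  exact: sqr_ge0.
have -> : M1 i j ^+ 2 + M2 i j ^+ 2 - 2 * (M1 i j * M2 i j) =
  (M1 i j - M2 i j) ^+ 2 by ring.
exact: sqr_ge0.
Qed.

Lemma time_derivative_qform n (f : R -> 'M[R]_n) s f' x :
  time_derivative f s f' ->
  time_derivative (fun r => qform (f r) x) s (qform f' x).
Proof.
move=> ff'.
have := time_derivative_mulmx
  (time_derivative_mulmx (time_derivative_cst x^T s) ff') (time_derivative_cst x s).
by rewrite mul0mx add0r mulmx0 addr0 => /time_derivative_mxP/(_ 0 0).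
Qed.

End TimeDerivative.

(** * The trapezoidal rule for Lipschitz functions *)

Section Trapezoid.
Variable R : realType.
Notation mu := (@lebesgue_measure R).

Lemma integrable_time (f : R -> R) a b : {within `[0, +oo[, continuous f} ->
  0 <= a -> mu.-integrable `[a, b] (EFin \o f).
Proof.
move=> fc a0; apply: continuous_compact_integrable; first exact: segment_compact.
apply: continuous_subspaceW fc => x /=.
by rewrite !in_itv/= => /andP[ax _]; rewrite (le_trans a0).
Qed.

Lemma Rintegral_sum (I : finType) (f : I -> R -> R) (a b : R) :
  (forall i, mu.-integrable `[a, b] (EFin \o f i)) ->
  \int[mu]_(s in `[a, b]) (\sum_i f i s) = \sum_i \int[mu]_(s in `[a, b]) f i s.
Proof.
move=> fi; rewrite /Rintegral.
under eq_integral do rewrite -sumEFin.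
rewrite (@integral_sum _ _ _ mu `[a, b] _ _ (fun i s => (f i s)%:E))//.
rewrite -sum_fine// => i _.
by apply: integrable_fin_num => //; exact: fi.
Qed.

Lemma Rintegral_chasles (f : R -> R) a c b : a <= c -> c <= b ->
  mu.-integrable `[a, b] (EFin \o f) ->
  \int[mu]_(s in `[a, b]) f s =
    \int[mu]_(s in `[a, c]) f s + \int[mu]_(s in `[c, b]) f s.
Proof.
move=> ac cb fi.
rewrite -[X in _ + X]Rintegral_itv_obnd_cbnd.
  by rewrite -(Rintegral_itvB fi) ?bnd_simp// addrC subrK.
apply: integrableS fi => //; apply: subset_itv; by rewrite bnd_simp.
Qed.

Lemma Rintegral_affine (a b c k : R) : a <= b ->
  \int[mu]_(s in `[a, b]) (c + k * (s - a)) =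
    c * (b - a) + k * (b - a) ^+ 2 / 2.
Proof.
rewrite le_eqVlt => /predU1P[<-|ab].
  by rewrite set_itv1 Rintegral_set1 subrr expr0n !mulr0 mul0r addr0.
pose F s := c * s + k / 2 * (s - a) ^+ 2.
have dF (s : R) : is_derive s 1 F (c + k * (s - a)).
  by apply: is_derive_eq; rewrite /GRing.scale/=; field.
have cF : continuous F.
  by move=> s; apply/differentiable_continuous/derivable1_diffP; have [] := dF s.
have cf : continuous (fun s : R => c + k * (s - a)).
  move=> s; apply/differentiable_continuous/derivable1_diffP.
  exact: ex_derive.
rewrite /Rintegral (@continuous_FTC2 _ _ F)//=.
- by rewrite /F; field.
- exact: continuous_subspaceT.
- split => //.
  + by apply: cvg_at_right_filter; exact: cF.
  + by apply: cvg_at_left_filter; exact: cF.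
- by move=> s _; rewrite derive1E; have [] := dF s.
Qed.

Lemma Rintegral_le_affine (f : R -> R) a b c k : a <= b ->
  mu.-integrable `[a, b] (EFin \o f) ->
  (forall s, a <= s <= b -> f s <= c + k * (s - a)) ->
  \int[mu]_(s in `[a, b]) f s <= c * (b - a) + k * (b - a) ^+ 2 / 2.
Proof.
move=> ab fi fle; rewrite -Rintegral_affine//; apply: le_Rintegral => //.
apply: continuous_compact_integrable; first exact: segment_compact.
apply: continuous_subspaceT => s.
apply/differentiable_continuous/derivable1_diffP; exact: ex_derive.
Qed.

(** Use the bound from the left end on the left half of the interval and the one
    from the right end on the right half: each half contributes an error of
    [M ((b - a) / 2)^2 / 2]. *)
Lemma Rintegral_le_trapezoid (f : R -> R) a b M : a <= b ->
  mu.-integrable `[a, b] (EFin \o f) ->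
  (forall s, a <= s <= b -> f s <= f a + M * (s - a)) ->
  (forall s, a <= s <= b -> f s <= f b + M * (b - s)) ->
  \int[mu]_(s in `[a, b]) f s <=
    (b - a) * (f a + f b) / 2 + M * (b - a) ^+ 2 / 4.
Proof.
move=> ab fi fa fb; pose c := (a + b) / 2.
have ac : a <= c by rewrite /c; lra.
have cb : c <= b by rewrite /c; lra.
rewrite (Rintegral_chasles ac cb fi).
have il : mu.-integrable `[a, c] (EFin \o f).
  by apply: integrableS fi => //; apply: subset_itv; rewrite bnd_simp.
have ir : mu.-integrable `[c, b] (EFin \o f).
  by apply: integrableS fi => //; apply: subset_itv; rewrite bnd_simp.
have l s : a <= s <= c -> f s <= f a + M * (s - a).
  by move=> /andP[? ?]; apply: fa; lra.
have r s : c <= s <= b -> f s <= (f b + M * (b - c)) + - M * (s - c).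
  move=> /andP[cs sb]; have -> : f b + M * (b - c) + - M * (s - c) =
    f b + M * (b - s) by ring.
  by apply: fb; rewrite (le_trans ac cs).
apply: le_trans (lerD (Rintegral_le_affine ac il l) (Rintegral_le_affine cb ir r)) _.
by rewrite le_eqVlt; apply/predU1P; left; rewrite /c; field.
Qed.

(** [M (p l.+1 - p l)^2 <= M h (p l.+1 - p l)], and the right-hand sides
    telescope. *)
Lemma Rintegral_le_trapezoids (f : R -> R) (p : nat -> R) (M h : R) k :
  {within `[0, +oo[, continuous f} -> 0 <= p 0%N -> 0 <= M ->
  (forall l, (l < k)%N -> p l <= p l.+1 <= p l + h) ->
  (forall x y, p 0%N <= x -> x <= y -> y <= p k ->
     `|f y - f x| <= M * (y - x)) ->
  \int[mu]_(s in `[p 0%N, p k]) f s <=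
    \sum_(l < k) (p l.+1 - p l) * (f (p l) + f (p l.+1)) / 2
    + M * h * (p k - p 0%N) / 4.
Proof.
move=> fc p0 M0; elim: k => [|k IHk] step lip.
  by rewrite big_ord0 set_itv1 Rintegral_set1 subrr mulr0 mul0r addr0.
have le0 l : (l <= k)%N -> p 0%N <= p l.
  elim: l => // l IHl lk; apply: le_trans (IHl (ltnW lk)) _.
  by have /andP[] := step l (leqW lk).
have pk := le0 _ (leqnn k); have /andP[pS pSh] := step k (ltnSn k).
rewrite (Rintegral_chasles pk pS); last exact: integrable_time.
have := IHk (fun l lk => step l (leqW lk))
  (fun x y px xy yp => lip x y px xy (le_trans yp pS)).
have lipl s : p k <= s <= p k.+1 -> f s <= f (p k) + M * (s - p k).
  move=> /andP[ks sk]; rewrite -lerBlDl.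
  exact: le_trans (ler_norm _) (lip _ _ pk ks sk).
have lipr s : p k <= s <= p k.+1 -> f s <= f (p k.+1) + M * (p k.+1 - s).
  move=> /andP[ks sk]; rewrite -lerBlDl.
  apply: le_trans (ler_norm _) _; rewrite distrC.
  by apply: lip => //; exact: le_trans ks.
have fi := integrable_time (p k.+1) fc (le_trans p0 pk).
have tr := Rintegral_le_trapezoid pS fi lipl lipr.
move=> IH; apply: le_trans (lerD IH tr) _; rewrite big_ord_recr /=.
have : M * ((p k.+1 - p k) * (p k.+1 - p k)) <= M * (h * (p k.+1 - p k)).
  by rewrite ler_wpM2l// ler_wpM2r ?subr_ge0// lerBlDl.
by lra.
Qed.

End Trapezoid.

(** * The Gramian kernel of a linear system *)

Section System.
Variable R : realType.
Notation mu := (@lebesgue_measure R).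

Variables (d m : nat) (A : R -> 'M[R]_d) (C : R -> 'M[R]_(m, d)).
Variable Phi : R -> R -> 'M[R]_d.

(** For fixed [t], [u s := frob2 (Phi s t)] satisfies
    [|u'| <= u + frob2 (A s *m Phi s t) <= (1 + b) u] with [b] a bound for
    [frob2 (A s)], and [u t = frob2 1%:M] does not depend on [t]. *)
Lemma fundamental_matrix_bounded (T : R) : {within `[0, +oo[, continuous A} ->
  is_fundamental_matrix A Phi ->
  exists2 B, 0 <= B &
    forall s t, 0 <= s <= T -> 0 <= t <= T -> frob2 (Phi s t) <= B.
Proof.
move=> Ac fundPhi; have [b b0 bA] := frob2_bounded T Ac.
exists (expR ((1 + b) * T) * frob2 (1%:M : 'M[R]_d)).
  by rewrite mulr_ge0 ?expR_ge0 ?frob2_ge0.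
move=> s t sT tT; have t0 : 0 <= t by case/andP: tT.
have [<- dPhi] := fundPhi t t0.
apply: (gronwall (fun x x0 => time_derivative_frob2 (dPhi x x0))) => //.
- by move=> x; exact: frob2_ge0.
- by rewrite addr_ge0.
- move=> x xT; apply: le_trans (frob2_dot_le _ _) _.
  rewrite mulrDl mul1r lerD2l; apply: le_trans (frob2M _ _) _.
  by rewrite ler_wpM2r ?frob2_ge0// bA.
Qed.

Lemma K_gram s t :
  K C Phi s t = (C s *m Phi s t)^T *m (C s *m Phi s t).
Proof. by rewrite trmx_mul !mulmxA. Qed.

Lemma K_sym s t : (K C Phi s t)^T = K C Phi s t.
Proof. by rewrite K_gram trmx_mul trmxK. Qed.

Lemma qform_K s t x : qform (K C Phi s t) x = frob2 (C s *m Phi s t *m x).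
Proof. by rewrite K_gram qform_gram. Qed.

Variable C' : R -> 'M[R]_(m, d).
Hypothesis C_C' : forall s : R, 0 <= s -> time_derivative C s (C' s).
Hypothesis fundPhi : is_fundamental_matrix A Phi.

(* [K] is the Gram matrix of [Z s t := C s *m Phi s t], and [dZ] is the derivative
   of [Z] in [s]. *)
Let dZ s t := C' s *m Phi s t + C s *m (A s *m Phi s t).

Lemma time_derivative_K_explicit (s t : R) : 0 <= s -> 0 <= t ->
  time_derivative (K C Phi ^~ t) s
    ((dZ s t)^T *m (C s *m Phi s t) + (C s *m Phi s t)^T *m dZ s t).
Proof.
move=> s0 t0; have [_ dPhi] := fundPhi t0.
have dZs := time_derivative_mulmx (C_C' s0) (dPhi s s0).
have := time_derivative_mulmx (time_derivative_tr dZs) dZs.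
by under [fun y => _ *m _]funext do rewrite -K_gram.
Qed.

Lemma Ks_explicit (s t : R) : 0 <= s -> 0 <= t ->
  Ks C Phi s t =
    (dZ s t)^T *m (C s *m Phi s t) + (C s *m Phi s t)^T *m dZ s t.
Proof.
move=> s0 t0; have F := time_filter_proper s0.
apply: cvg_lim; first exact: norm_hausdorff.
exact: time_derivative_K_explicit.
Qed.

Lemma time_derivative_K (s t : R) : 0 <= s -> 0 <= t ->
  time_derivative (K C Phi ^~ t) s (Ks C Phi s t).
Proof.
by move=> s0 t0; rewrite Ks_explicit//; exact: time_derivative_K_explicit.
Qed.

Lemma Ks_bounded (T : R) : {within `[0, +oo[, continuous A} ->
  {within `[0, +oo[, continuous C'} ->
  exists B, forall s t, 0 <= s <= T -> 0 <= t <= T -> frob2 (Ks C Phi s t) <= B.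
Proof.
move=> Ac C'c.
have [bP bP0 HP] := fundamental_matrix_bounded T Ac fundPhi.
have [bA bA0 HA] := frob2_bounded T Ac.
have [bC bC0 HC] := frob2_bounded T (time_derivative_continuous C_C').
have [bD bD0 HD] := frob2_bounded T C'c.
pose bZ := bC * bP; pose bdZ := 2 * (bD * bP + bC * (bA * bP)).
exists (2 * (bdZ * bZ + bZ * bdZ)) => s t sT tT.
have mulP p q r (M : 'M[R]_(p, q)) (N : 'M[R]_(q, r)) x y :
    frob2 M <= x -> frob2 N <= y -> frob2 (M *m N) <= x * y.
  by move=> Mx Ny; apply: le_trans (frob2M _ _) _; rewrite ler_pM ?frob2_ge0.
have addP p q (M N : 'M[R]_(p, q)) x y :
    frob2 M <= x -> frob2 N <= y -> frob2 (M + N) <= 2 * (x + y).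
  move=> Mx Ny; apply: le_trans (frob2D _ _) _.
  by rewrite ler_wpM2l// lerD.
have Zb : frob2 (C s *m Phi s t) <= bZ by apply: (@mulP); [exact: HC|exact: HP].
have dZb : frob2 (dZ s t) <= bdZ.
  apply: (@addP); first by apply: (@mulP); [exact: HD|exact: HP].
  by apply: (@mulP); [exact: HC|apply: (@mulP); [exact: HA|exact: HP]].
rewrite Ks_explicit; [|by case/andP: sT|by case/andP: tT].
by apply: (@addP); apply: (@mulP); rewrite ?frob2_tr.
Qed.

Lemma qform_gramian (vs t : R) x : 0 <= t -> 0 <= vs ->
  qform (gramian C Phi vs t) x =
    \int[mu]_(s in `[t, t + vs]) qform (K C Phi s (t + vs)) x.
Proof.
move=> t0 vs0; have tvs0 : 0 <= t + vs by rewrite addr_ge0.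
have Kint i j : mu.-integrable `[t, t + vs]
    (EFin \o (fun s => K C Phi s (t + vs) i j)).
  apply: integrable_time t0.
  apply: (@time_derivative_continuous _ _ _ (fun s => Ks C Phi s (t + vs) i j)).
  move=> s s0.
  by have /time_derivative_mxP := time_derivative_K s0 tvs0; apply.
have xKxint i j : mu.-integrable `[t, t + vs]
    (EFin \o (fun s => x i 0 * K C Phi s (t + vs) i j * x j 0)).
  have : mu.-integrable `[t, t + vs]
      (fun s => ((x i 0 * x j 0)%:E * (K C Phi s (t + vs) i j)%:E)%E).
    by apply: integrableZl => //; exact: Kint.
  congr (_.-integrable _ _); apply/funext => s /=.
  by rewrite -EFinM mulrAC.
under eq_Rintegral do rewrite qformE.
rewrite qformE Rintegral_sum => [|i]; last first.
  have : mu.-integrable `[t, t + vs] (fun s =>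
      (\sum_j (x i 0 * K C Phi s (t + vs) i j * x j 0)%:E)%E).
    by apply: integrable_sum => // j _; exact: xKxint.
  congr (_.-integrable _ _); apply/funext => s /=.
  by rewrite sumEFin.
apply: eq_bigr => i _; rewrite Rintegral_sum//.
apply: eq_bigr => j _; rewrite mxE -mulrA mulrCA mulrC -RintegralZl//.
by apply: eq_Rintegral => s _; ring.
Qed.

Lemma gramian_sym (vs t : R) : (gramian C Phi vs t)^T = gramian C Phi vs t.
Proof.
apply/matrixP => i j; rewrite !mxE; apply: eq_Rintegral => s _.
by rewrite -[in LHS]K_sym mxE.
Qed.

Lemma qform_gramian_ge0 (vs t : R) x : 0 <= t -> 0 <= vs ->
  0 <= qform (gramian C Phi vs t) x.
Proof.
move=> t0 vs0; rewrite qform_gramian//; apply: Rintegral_ge0 => s _.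
by rewrite qform_K frob2_ge0.
Qed.

(** The infimum defining [lambda_star] is over a set bounded below by [0], since
    Gramians are positive semidefinite. *)
Lemma lambda_star_qform (vs T t : R) x : (0 < d)%N -> 0 <= vs ->
  0 <= t <= T - vs ->
  lambda_star C Phi vs T * frob2 x <= qform (gramian C Phi vs t) x.
Proof.
move=> d0 vs0 tT.
apply: le_trans (lambda_min_qform x d0 (gramian_sym vs t)).
rewrite ler_wpM2r ?frob2_ge0//; apply: ge_inf; last first.
  by exists t => //=; rewrite in_itv.
exists 0 => _ [s /= + <-]; rewrite in_itv/= => /andP[s0 _].
apply: lambda_min_ge => //; first exact: gramian_sym.
by move=> y; rewrite mul0r qform_gramian_ge0.
Qed.

Lemma opnorm_le_Ks_max (lo up T s t : R) : {within `[0, +oo[, continuous A} ->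
  {within `[0, +oo[, continuous C'} -> 0 <= lo ->
  lo <= t <= T -> Num.max 0 (t - up) <= s <= t ->
  opnorm (Ks C Phi s t) <= Ks_max C Phi lo up T.
Proof.
move=> Ac C'c lo0 tT st; apply: ub_le_sup; last by exists s, t.
have [B KsB] := Ks_bounded T Ac C'c.
exists (Num.sqrt B) => _ [s' [t' [/andP[lot' t'T] /andP[+ s't'] ->]]].
rewrite ge_max => /andP[s'0 _].
apply: le_trans (opnorm_le_frob _) _; rewrite ler_wsqrtr// KsB//.
  by rewrite s'0 (le_trans s't').
by rewrite t'T andbT (le_trans lo0).
Qed.

End System.

(** * Sampled Gramians *)

Section SampledGramian.
Variable R : realType.

(** In [\bar R] the inverse of [0] is [+oo], so a positive lower bound on
    [X / Y] still forces [X] to be positive when [Y = 0]. *)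
Lemma lee_div_EFin (D X Y : R) : 0 < D -> 0 <= Y ->
  (D%:E <= X%:E / Y%:E)%E -> 0 < X /\ D * Y <= X.
Proof.
move=> D0; rewrite le_eqVlt => /predU1P[<-|Y0].
  rewrite inver eqxx mulry; case: sgrP => [_|X0 _|_].
  - by rewrite mul0e lee_fin leNgt D0.
  - by rewrite mulr0 ltW.
  - by rewrite mulN1e leeNy_eq.
rewrite inver gt_eqF// -EFinM lee_fin ler_pdivlMr// => DYX.
by split => //; apply: lt_le_trans DYX; rewrite mulr_gt0.
Qed.

Variables (N ell : nat) (t : nat -> nat -> R).

Lemma tau_low_le i : (1 <= i <= N)%N -> tau_low N ell t <= tau ell t i.
Proof.
by move=> iN; apply: (@bigmin_inf_seq _ _ _ _ _ i); rewrite ?mem_index_iota.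
Qed.

Lemma tau_up_ge i : (1 <= i <= N)%N -> tau ell t i <= tau_up N ell t.
Proof.
by move=> iN; apply: (@bigmax_sup_seq _ _ _ _ _ i); rewrite ?mem_index_iota.
Qed.

Lemma tau_low_ge0 : (0 < N)%N ->
  (forall i, (1 <= i <= N)%N -> 0 <= tau ell t i) -> 0 <= tau_low N ell t.
Proof.
move=> N0 tau0; rewrite /tau_low big_seq.
apply: (big_ind (fun x => 0 <= x)) => [|x y x0 y0|i]; first exact: tau0.
  by rewrite le_min x0.
by rewrite mem_index_iota; exact: tau0.
Qed.

Section OneTrajectory.
Variable i : nat.
Hypothesis ell2 : (2 <= ell)%N.
Hypothesis t_lt : forall l, (1 <= l < ell)%N -> t i l < t i l.+1.

(** Each sample receives half the length of every step that it bounds; the two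
    conditionals drop the missing step at the ends. *)
Lemma weight_sqr l : (l < ell)%N ->
  weight ell t i l.+1 ^+ 2 =
    (if l == 0%N then 0 else taul t i l / 2) +
    (if l == ell.-1 then 0 else taul t i l.+1 / 2).
Proof.
move=> l_lt; have taul_ge0 k : (1 <= k < ell)%N -> 0 <= taul t i k.
  by move=> /t_lt/ltW; rewrite /taul subr_ge0.
rewrite /weight eqSS; have [->|l0] := eqVneq l 0%N.
  rewrite sqr_sqrtr ?divr_ge0 ?taul_ge0// add0r.
  by case: eqVneq => // l1; move: ell2; rewrite -(prednK (ltnW ell2)) -l1.
have -> : (l.+1 == ell) = (l == ell.-1).
  by rewrite -[in LHS](prednK (ltnW ell2)) eqSS.
have l_gt0 : (0 < l)%N by rewrite lt0n.
have [->|l1] := eqVneq l ell.-1.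
  rewrite /= sqr_sqrtr ?addr0// divr_ge0// taul_ge0//.
  by rewrite ltn_predL (ltnW ell2) -ltnS (prednK (ltnW ell2)) andbT.
have lS : (l.+1 < ell)%N.
  by rewrite -[X in (_ < X)%N](prednK (ltnW ell2)) ltnS ltn_neqAle l1 -ltnS
    (prednK (ltnW ell2)).
by rewrite sqr_sqrtr mulrDl// addr_ge0 ?divr_ge0 ?taul_ge0 ?l_gt0.
Qed.

Lemma sum_weight_trapezoid (g : nat -> R) :
  \sum_(l < ell) weight ell t i l.+1 ^+ 2 * g l =
  \sum_(l < ell.-1) (t i l.+2 - t i l.+1) * (g l + g l.+1) / 2.
Proof.
under eq_bigr => l _ do rewrite weight_sqr// mulrDl.
rewrite big_split /=.
move: ell2; case: ell => [|[|n]]// _ /=.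
rewrite big_ord_recl /= mul0r add0r [X in _ + X]big_ord_recr /= eqxx mul0r addr0.
rewrite -big_split; apply: eq_bigr => l _ /=.
by rewrite (ltn_eqF (ltn_ord l)) /bump /= add1n /taul; ring.
Qed.

Variables (d m : nat) (C : R -> 'M[R]_(m, d)) (Phi : R -> R -> 'M[R]_d).
Let O := obs_mx ell t C Phi i.
Let W := weight_mx ell t m i.

Lemma weight_mx_diag :
  W = diag_mx (\row_k weight ell t i (mxtens_unindex k).1.+1).
Proof.
apply/matrixP => k k'; rewrite /W /weight_mx.
case: (mxtens_indexP k) => l r; case: (mxtens_indexP k') => l' r'.
rewrite tensmxE !mxE mxtens_indexK /=.
rewrite (can_eq (@mxtens_indexK _ _)) xpair_eqE.
by case: eqP => _; case: eqP => _; rewrite ?mulr1n ?mulr0n ?mulr1 ?mulr0 ?mul0r.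
Qed.

Lemma weighted_obs_gram : O^T *m W *m W *m O = (W *m O)^T *m (W *m O).
Proof. by rewrite trmx_mul weight_mx_diag tr_diag_mx !mulmxA. Qed.

Lemma qform_weighted_obs x :
  qform (O^T *m W *m W *m O) x =
  \sum_(l < ell) weight ell t i l.+1 ^+ 2 *
    qform (K C Phi (t i l.+1) (t i ell)) x.
Proof.
rewrite weighted_obs_gram qform_gram weight_mx_diag mul_diag_mx.
rewrite /frob2 (reindex (@mxtens_index ell m)) /=; last first.
  by exists (@mxtens_unindex _ _) => k _; rewrite (mxtens_indexK, mxtens_unindexK).
pose G (l : 'I_ell) (r : 'I_m) := weight ell t i l.+1 ^+ 2 *
  (C (t i l.+1) *m Phi (t i l.+1) (t i ell) *m x) r 0 ^+ 2.
rewrite (eq_bigr (fun p => G p.1 p.2)) => [|[l r] _].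
  rewrite -(pair_bigA _ G) /=; apply: eq_bigr => l _.
  rewrite qform_K /frob2 mulr_sumr; apply: eq_bigr => r _.
  by rewrite big_ord1.
rewrite big_ord1 /G /= -exprMn; congr (_ ^+ 2).
rewrite !mxE mulr_sumr; apply: eq_bigr => j _.
have lE : (mxtens_index (l, r) %/ m)%N = l.
  exact: (congr1 (fun p => val p.1) (mxtens_indexK (l, r))).
by rewrite !mxE mxtens_indexK mulrA /= mxE lE.
Qed.

End OneTrajectory.
End SampledGramian.

(** * Sampled-data observability *)

Theorem propositionV4 (R : realType) (d m N ell : nat)
    (A : R -> 'M[R]_d) (C : R -> 'M[R]_(m, d)) (Phi : R -> R -> 'M[R]_d)
    (t : nat -> nat -> R) (T a Delta : R)
    (d_gt0 : (0 < d)%N) (m_gt0 : (0 < m)%N) (N_gt0 : (0 < N)%N)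
    (ell_ge2 : (2 <= ell)%N)
    (t_sampling : is_sampling N ell t T)
    (A_continuous : {within `[0, +oo[, continuous A})
    (C_C1 : continuously_differentiable C)
    (Phi_fundamental : is_fundamental_matrix A Phi)
    (AC_observable : forall a' b' : R,
       0 <= a' -> a' < b' -> b' <= T -> observable_on A C a' b')
    (a01 : 0 < a < 1)
    (Delta_bound : is_intersampling_bound N ell t Delta)
    (Delta_le :
       (Delta%:E <=
        (4 * (1 - a) * lambda_star C Phi (tau_low N ell t) T)%:E /
        (tau_up N ell t *
         Ks_max C Phi (tau_low N ell t) (tau_up N ell t) T)%:E)%E) :
  sampled_data_observable N ell t C Phi /\
  forall i, (1 <= i <= N)%N ->
    lambda_min ((obs_mx ell t C Phi i)^T *m weight_mx ell t m i
                *m weight_mx ell t m i *m obs_mx ell t C Phi i)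
    >= a * lambda_star C Phi (tau_low N ell t) T.
Proof.
have [C' [C_C' C'c]] := C_C1.
have [t_ge0 t_lt t_leT _ _] := t_sampling.
have [Delta0 t_Delta] := Delta_bound.
have /andP[a0 a1] := a01.
set lo := tau_low N ell t in Delta_le *; set up := tau_up N ell t in Delta_le.
set Km := Ks_max C Phi lo up T in Delta_le.
set lam := lambda_star C Phi lo T in Delta_le *.
have t1_le i l : (1 <= i <= N)%N -> (1 <= l <= ell)%N -> t i 1%N <= t i l.
  move=> iN; elim: l => // -[|l] IHl// lell.
  by apply: le_trans (IHl (ltnW lell)) (ltW (t_lt _ _ iN _)).
have tau0 i : (1 <= i <= N)%N -> 0 <= tau ell t i.
  by move=> iN; rewrite /tau subr_ge0 t1_le// (ltnW ell_ge2) leqnn.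
have lo0 : 0 <= lo by exact: tau_low_ge0.
have up0 : 0 <= up by apply: le_trans (tau_up_ge ell t (i := 1%N) _); [exact: tau0|].
have lo_le i (iN : (1 <= i <= N)%N) : lo <= t i ell.
  apply: le_trans (tau_low_le ell t iN) _.
  by rewrite /tau gerBl t_ge0.
have Km_ge s i : (1 <= i <= N)%N -> t i 1%N <= s <= t i ell ->
    opnorm (Ks C Phi s (t i ell)) <= Km.
  move=> iN /andP[ts st].
  apply: (opnorm_le_Ks_max C_C' Phi_fundamental A_continuous C'c lo0).
    by rewrite lo_le// t_leT.
  rewrite ge_max st andbT (le_trans (t_ge0 _ iN) ts) /=.
  by apply: le_trans ts; rewrite lerBlDr -lerBlDl; exact: tau_up_ge.
have Km0 : 0 <= Km.
  apply: le_trans (Km_ge (t 1%N ell) 1%N _ _); [exact: opnorm_ge0|by []|].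
  by rewrite lexx andbT t1_le// (ltnW ell_ge2) leqnn.
have [lam4_gt0 DeltaK] := lee_div_EFin Delta0 (mulr_ge0 up0 Km0) Delta_le.
have lam0 : 0 < lam by move: lam4_gt0; rewrite pmulr_rgt0// mulr_gt0// subr_gt0.
have key i x : (1 <= i <= N)%N -> a * lam * frob2 x <=
    qform ((obs_mx ell t C Phi i)^T *m weight_mx ell t m i
           *m weight_mx ell t m i *m obs_mx ell t C Phi i) x.
  move=> iN; have fx := frob2_ge0 x.
  set te := t i ell; pose g s := qform (K C Phi s te) x.
  have te0 : 0 <= te := le_trans lo0 (lo_le i iN).
  have dg s : 0 <= s -> time_derivative g s (qform (Ks C Phi s te) x).
    by move=> s0; apply: time_derivative_qform;
      exact: (time_derivative_K C_C' Phi_fundamental).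
  have gc := time_derivative_continuous dg.
  (* The Gramian at time [te - lo] covers the last [lo] time units. *)
  have lower : lam * frob2 x <= \int[lebesgue_measure]_(s in `[t i 1%N, te]) g s.
    have t1_lo : t i 1%N <= te - lo.
      by rewrite lerBrDr -lerBrDl; exact: tau_low_le.
    have lo_te : te - lo <= te by rewrite gerBl.
    rewrite (Rintegral_chasles t1_lo lo_te); last first.
      by apply: integrable_time => //; exact: t_ge0.
    apply: (@le_trans _ _ (qform (gramian C Phi lo (te - lo)) x)).
      apply: (lambda_star_qform C_C' Phi_fundamental) => //.
      by rewrite subr_ge0 lo_le// lerD2r t_leT.
    rewrite (qform_gramian C_C' Phi_fundamental) ?subr_ge0 ?lo_le//.
    rewrite subrK lerDr; apply: Rintegral_ge0 => s _.
    by rewrite /g qform_K frob2_ge0.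
  have lip u v : t i 1%N <= u -> u <= v -> v <= te ->
      `|g v - g u| <= Km * frob2 x * (v - u).
    move=> tu uv vt; have u0 := le_trans (t_ge0 _ iN) tu.
    have [c /andP[uc cv] ->] := mean_value dg u0 uv.
    rewrite normrM (ger0_norm (_ : 0 <= v - u)) ?subr_ge0//.
    rewrite ler_wpM2r ?subr_ge0//; apply: le_trans (qform_le_opnorm _ _) _.
    by rewrite ler_wpM2r// Km_ge// (le_trans tu uc) (le_trans cv vt).
  have ellK := prednK (ltnW ell_ge2).
  have upper := @Rintegral_le_trapezoids R g (fun l => t i l.+1)
    (Km * frob2 x) Delta ell.-1 gc (t_ge0 _ iN) (mulr_ge0 Km0 fx).
  rewrite /= ellK in upper.
  have {}upper := upper _ lip.
  rewrite qform_weighted_obs (sum_weight_trapezoid ell_ge2 (t_lt _ ^~ iN)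
    (fun l => g (t i l.+1))).
  have step l : (l < ell.-1)%N -> t i l.+1 <= t i l.+2 <= t i l.+1 + Delta.
    move=> l_lt; have lS : (l.+1 < ell)%N by rewrite -ellK ltnS.
    by rewrite ltW ?t_lt//= -lerBlDl (t_Delta i l.+2).
  have {}upper := le_trans lower (upper step).
  have : Km * frob2 x * Delta * (te - t i 1%N) <= 4 * (1 - a) * lam * frob2 x.
    apply: (@le_trans _ _ (Km * frob2 x * Delta * up)).
      apply: ler_wpM2l; first by rewrite !mulr_ge0// ltW.
      exact: (tau_up_ge ell t iN).
    have := ler_wpM2r fx DeltaK.
    by congr (_ <= _); ring.
  move: upper; rewrite -/te; set S := \sum_(l < _) _.
  set D := Km * _ * _ * _.
  by lra.
split=> i iN.
  have Gu := posdef_unitmx (mulr_gt0 a0 lam0) (fun x => key i x iN).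
  exists (invmx ((obs_mx ell t C Phi i)^T *m weight_mx ell t m i
           *m weight_mx ell t m i *m obs_mx ell t C Phi i) *m
    ((obs_mx ell t C Phi i)^T *m weight_mx ell t m i *m weight_mx ell t m i)).
  by rewrite -(mulmxA (invmx _)) mulVmx.
apply: lambda_min_ge => //; last by move=> x; exact: key.
by rewrite weighted_obs_gram trmx_mul trmxK.
Qed.
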